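(* Let $n\ge 2$ be an integer. The graph on $Z_n^*=Z_n\setminus\{0\}$ generated by $T(x)=2x$ has exactly one connected component if and only if $n$ is a power of $2$ or $n$ is a prime $p$ for which $2$ is a primitive root modulo $p$.
   Context: $Z_n=\mathbb{Z}/n\mathbb{Z}$ and $Z_n^*=Z_n\setminus\{0\}$ denotes the set of nonzero residue classes modulo $n$ (not the group of units). The graph generated by a map $T:Z_n\to Z_n$ on a vertex set $V\subseteq Z_n$ is the finite simple undirected graph with vertex set $V$ in which two distinct points $x,y\in V$ are joined by an edge if and only if $T(x)=y$ or $T(y)=x$ (directions, self-loops and multiple connections are disregarded). An integer $a$ is a primitive root modulo a prime $p$ if its class generates the multiplicative group of $\mathbb{Z}/p\mathbb{Z}$. *)

(* Defs.v *)
From HB Require Import structures.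
From mathcomp Require Import all_boot all_order all_algebra all_fingroup all_solvable.

Set Implicit Arguments.
Unset Strict Implicit.
Unset Printing Implicit Defensive.

Import GRing.Theory.
Local Open Scope ring_scope.

Section MapGraph.

Variables (U : finType) (f : U -> U) (V : {set U}).

(* The vertex type is V itself, so an edge needs both endpoints in V even when
   f does not preserve V. *)
Definition map_graph : rel {x : U | x \in V} :=
  fun x y => (x != y) && ((f (val x) == val y) || (f (val y) == val x)).

Lemma map_graph_irr : irreflexive map_graph.
Proof. by move=> x; rewrite /map_graph eqxx. Qed.

Lemma map_graph_sym : symmetric map_graph.
Proof. by move=> x y; rewrite /map_graph eq_sym orbC. Qed.

(* n_comp counts connected components only under this hypothesis. *)
Lemma map_graph_connect_sym : connect_sym map_graph.
Proof. exact: (sym_connect_sym map_graph_sym). Qed.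

Definition num_components : nat := n_comp map_graph {: {x : U | x \in V}}.

End MapGraph.

(* Meaningful for p prime only: otherwise 'F_p is not the ring of integers
   modulo p. *)
Definition primitive_root (p : nat) (a : int) : Prop :=
  exists2 u : {unit 'F_p}, val u = a%:~R & generator [set: {unit 'F_p}] u.

(* Main.v *)
Require Import Defs.
From HB Require Import structures.
From mathcomp Require Import all_boot all_order all_algebra all_fingroup all_solvable.

Set Implicit Arguments.
Unset Strict Implicit.
Unset Printing Implicit Defensive.

Import GRing.Theory.
Local Open Scope ring_scope.

(** Two vertices joined by a path in the graph of a map [f] have forward
    orbits that meet, because [f] sends both ends of an edge into a common
    orbit.  For doubling on the nonzero residues modulo [n], connectedness
    therefore gives [2 ^ i = 2 ^ j * y] modulo [n] for every [y != 0]
    ([connected_doubling_eq]).  If [n] has an odd prime factor [p] and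
    [p != n], the choice [y = p] makes [p] divide a power of [2], which is
    absurd; so [n] is a power of [2] or an odd prime.  In the prime case the
    same equation, read in the group of units, puts every unit in the cyclic
    group generated by [2].

    Conversely, a forward orbit that avoids [0] up to some point is a path of
    the graph ([connect_iter]).  If [n] is a power of [2], doubling a nonzero
    [x] repeatedly reaches [0], and the last nonzero residue met is always
    [n / 2], the only one killed by [2]; so every vertex is joined to [n / 2].
    If [n] is prime and [2] is a primitive root, the forward orbit of [1] is
    the whole vertex set. *)

(** The components are counted by their canonical roots, so there is exactly
    one component when every root coincides with that of [x0]. *)
Lemma n_comp1P (T : finType) (e : rel T) (x0 : T) :
  connect_sym e -> n_comp e T = 1%N <-> forall y, connect e x0 y.
Proof.
move=> sym_e; split=> [n1 y | conn]; last first.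
  rewrite -(n_comp_connect sym_e x0); apply: eq_n_comp_r => y.
  by rewrite [RHS]conn.
have [r def_r] := mem_card1 n1.
have rootE x : fingraph.root e x = r.
  apply/eqP; rewrite -[_ == r](def_r (fingraph.root e x)) inE /=.
  by rewrite unfold_in /= roots_root.
by rewrite -root_connect // !rootE.
Qed.

Section MapGraphConnect.

Variables (U : finType) (f : U -> U) (V : {set U}).
Implicit Types x y : {x : U | x \in V}.

(** Having a common forward iterate is an equivalence relation, since iterates
    of [f] commute, and it holds along every edge. *)
Lemma connect_orbits_meet x y :
  connect (map_graph f (V := V)) x y ->
  exists i j, iter i f (val x) = iter j f (val y).
Proof.
case/connectP=> s; elim: s x => [|z s IHs] x /=.
  by move=> _ ->; exists 0%N, 0%N.
case/andP=> /andP[_ xz] path_s last_s.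
have [i [j def_z]] := IHs z path_s last_s.
have [fx | fz] := orP xz.
  by exists i.+1, j; rewrite iterSr (eqP fx).
exists i, j.+1; rewrite -(eqP fz) -iterSr.
by rewrite !iterS def_z.
Qed.

Lemma connect_iter i x y :
    (forall k, (k <= i)%N -> iter k f (val x) \in V) ->
  iter i f (val x) = val y -> connect (map_graph f (V := V)) x y.
Proof.
elim: i x => [|i IHi] x orbV; first by move/val_inj->.
have Vfx : f (val x) \in V := orbV 1%N isT.
rewrite iterSr => fxy.
apply: (@connect_trans _ _ (exist _ (f (val x)) Vfx)); last first.
  by apply: IHi => // k le_ki; rewrite -iterSr; apply: orbV.
(* A fixed point of f is not an edge, but then the step is trivial. *)
have [<- // | neq] := eqVneq x (exist _ (f (val x)) Vfx).
by apply: connect1; rewrite /map_graph neq /= eqxx.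
Qed.

End MapGraphConnect.

Lemma iter_double (R : pzRingType) i (x : R) :
  iter i (fun y => 2 * y) x = 2 ^+ i * x.
Proof. by elim: i => [|i IHi]; rewrite ?mul1r //= IHi mulrA exprS. Qed.

Lemma Zp_nat_eq0 n m : (1 < n)%N -> ((m%:R : 'Z_n) == 0) = (n %| m)%N.
Proof. by move=> n_gt1; rewrite -val_eqE /= val_Zp_nat. Qed.

(** For [n] prime the field ['F_n] is the ring ['Z_n] on which the graph
    lives. *)
Lemma primitive_root_Zp n a : prime n ->
  primitive_root n a <->
  exists2 u : {unit 'Z_n}, val u = a%:~R & generator [set: {unit 'Z_n}] u.
Proof. by move=> n_pr; rewrite /primitive_root (pdiv_id n_pr). Qed.

Section Doubling.

Variables (n : nat) (n_gt1 : (1 < n)%N).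

Let V := [set x : 'Z_n | x != 0].
Let T := fun x : 'Z_n => 2 * x.

Let V1 : 1 \in V.
Proof. by rewrite inE oner_eq0. Qed.

Lemma connected_doublingP x0 :
  num_components T V = 1%N <-> forall y, connect (map_graph T (V := V)) x0 y.
Proof. exact: n_comp1P x0 (@map_graph_connect_sym _ T V). Qed.

Lemma connected_doubling_eq :
    num_components T V = 1%N ->
  forall y : 'Z_n, y != 0 -> exists i j, 2 ^+ i = 2 ^+ j * y.
Proof.
move=> /(connected_doublingP (exist _ 1 V1)) conn y y_neq0.
have Vy : y \in V by rewrite inE.
have [i [j]] := connect_orbits_meet (conn (exist _ y Vy)).
by rewrite !iter_double mulr1 => eq_ij; exists i, j.
Qed.

(** If [p] were a proper divisor, its class would be a vertex, and meeting the
    orbit of [1] would force the odd prime [p] to divide a power of [2]. *)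
Lemma odd_prime_factor_connected_doubling p :
  prime p -> odd p -> (p %| n)%N -> num_components T V = 1%N -> p = n.
Proof.
move=> p_pr p_odd p_n /connected_doubling_eq meet.
apply/eqP; rewrite eqn_dvd p_n -Zp_nat_eq0 //=.
apply: contraT => /meet[i [j]].
rewrite -!natrX -natrM => /(congr1 val); rewrite /= !val_Zp_nat // => eq_n.
(* The congruence modulo n descends to its divisor p. *)
have: (p %| 2 ^ i)%N.
  by rewrite /dvdn -(modn_dvdm _ p_n) eq_n modn_dvdm // modnMl.
by rewrite Euclid_dvdX // dvdn_prime2 // => /andP[/eqP p2]; rewrite p2 in p_odd.
Qed.

(** Since [2] is a unit, [2 ^ i = 2 ^ j * y] solves to [y = 2 ^ (i - j)]. *)
Lemma connected_doubling_primitive_root :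
  prime n -> odd n -> num_components T V = 1%N -> primitive_root n 2.
Proof.
move=> n_pr n_odd /connected_doubling_eq meet.
apply/primitive_root_Zp => //.
have u2 : (2 : 'Z_n) \is a GRing.unit.
  by rewrite unitZpE // coprimen2.
exists (FinRing.unit 'Z_n u2) => //.
rewrite /generator eqEsubset subsetT andbT.
apply/subsetP=> y _.
have y_neq0 : val y != 0.
  by apply: contraTneq (valP y) => ->; rewrite unitr0.
have [i [j eq_ij]] := meet _ y_neq0.
set u := FinRing.unit _ _.
suff -> : y = ((u ^+ j)^-1 * u ^+ i)%g by rewrite groupM ?groupV ?mem_cycle.
apply: (canRL (mulKg _)); apply: val_inj.
by rewrite FinRing.val_unitM !FinRing.val_unitX.
Qed.

(** Doubling any nonzero residue modulo [2 ^ k] ends at [0], and its last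
    nonzero value has double [0], hence is [n / 2]. *)
Lemma pow2_connected_doubling k : n = (2 ^ k)%N -> num_components T V = 1%N.
Proof.
move=> def_n.
have k_gt0 : (0 < k)%N by case: k def_n n_gt1 => // ->.
have def_half : n = (2 * 2 ^ k.-1)%N by rewrite -expnS prednK.
have half_neq0 : ((2 ^ k.-1)%:R : 'Z_n) != 0.
  by rewrite Zp_nat_eq0 // def_n dvdn_Pexp2l // -ltnNge prednK.
have Vhalf : ((2 ^ k.-1)%:R : 'Z_n) \in V by rewrite inE.
apply/(connected_doublingP (exist _ (2 ^ k.-1)%:R Vhalf)) => y.
rewrite map_graph_connect_sym.
have y_neq0 : val y != 0 by have := valP y; rewrite inE.
have ex0 : exists i, 2 ^+ i * val y == 0.
  exists k; rewrite -natrX -def_n.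
  by have /eqP -> : (n%:R : 'Z_n) == 0 by rewrite Zp_nat_eq0.
case: (ex_minnP ex0) => -[|i]; first by rewrite mul1r (negPf y_neq0).
move=> y0 min_i.
apply: (@connect_iter _ _ _ i) => [j le_ji|].
  by rewrite inE iter_double; apply: contraL le_ji => /min_i; rewrite -ltnNge.
have z_neq0 : 2 ^+ i * val y != 0.
  by apply/negP=> /min_i; rewrite ltnn.
rewrite iter_double /=; move: y0 z_neq0; rewrite exprS -mulrA.
move: (2 ^+ i * val y) => z.
rewrite -[z]natr_Zp -natrM !Zp_nat_eq0 // => n_2z n_z.
congr _%:R; move: n_2z; rewrite {1}def_half dvdn_pmul2l // => /dvdnP[c def_z].
have z_lt : (z < n)%N by rewrite -[X in (_ < X)%N]Zp_cast.
(* The multiplier c of n / 2 satisfies 0 < c < 2, so it is 1. *)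
move: z_lt n_z; rewrite def_z {1 2}def_half ltn_pmul2r ?expn_gt0 //.
by case: c {def_z} => [|[|]] //; rewrite ?dvdn0 ?mul1n.
Qed.

Lemma primitive_root_connected_doubling :
  prime n -> primitive_root n 2 -> num_components T V = 1%N.
Proof.
move=> n_pr /(primitive_root_Zp _ n_pr)[u u2 gen_u].
apply/(connected_doublingP (exist _ 1 V1)) => y.
have Vpow i : 2 ^+ i * 1 \in V.
  have <- : val (u ^+ i)%g = 2 ^+ i * 1.
    by rewrite FinRing.val_unitX u2 mulr1.
  by rewrite inE; apply: contraTneq (valP (u ^+ i)%g) => ->; rewrite unitr0.
have y_unit : val y \is a GRing.unit.
  have := valP y; rewrite inE -[val y]natr_Zp Zp_nat_eq0 // unitZpE //.
  by rewrite prime_coprime.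
have: FinRing.unit _ y_unit \in <[u]>%g by rewrite -(eqP gen_u) inE.
case/cycleP=> i /(congr1 val); rewrite FinRing.val_unitX u2 /= => def_y.
apply: (@connect_iter _ _ _ i) => [k _|]; rewrite iter_double //=.
by rewrite mulr1 def_y.
Qed.

End Doubling.

Theorem proposition2 (n : nat) (hn : (2 <= n)%N) :
  num_components (fun x : 'Z_n => 2 * x) [set x : 'Z_n | x != 0] = 1%N <->
  (exists k : nat, n = (2 ^ k)%N) \/ (prime n /\ primitive_root n 2).
Proof.
split=> [conn | [[k def_n] | [n_pr root2]]]; last 2 first.
- exact: pow2_connected_doubling def_n.
- exact: primitive_root_connected_doubling.
have [pow2 | not_pow2] := boolP (2%N.-nat n).
  by left; have [k ->] := p_natP pow2; exists k.
(* A number that is not a power of 2 has a prime factor other than 2. *)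
right; move: not_pow2; rewrite /pnat ltnW //=.
case/allPn=> p; rewrite mem_primes inE => /and3P[p_pr _ p_n] p_neq2.
have p_odd : odd p.
  by apply: contraNT p_neq2; rewrite -dvdn2 dvdn_prime2 // eq_sym.
have def_p := odd_prime_factor_connected_doubling hn p_pr p_odd p_n conn.
rewrite def_p in p_pr p_odd.
by split=> //; apply: connected_doubling_primitive_root.
Qed.
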